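(* Let $n\ge1$ and let $\alpha\vDash n$ be a composition of length $\ell$. Put $\beta^\rho_\alpha=(n-\ell+1,1^{\ell-1})$. Then the leading term (with respect to the lexicographic order) in the $\mathfrak{S}^*$-expansion of $\rho(\mathfrak{S}^*_\alpha)$ is indexed by $\beta^\rho_\alpha$, and $[\mathfrak{S}^*_{\beta^\rho_\alpha}]\rho(\mathfrak{S}^*_\alpha)=1$. Moreover, there is a unique semi-standard reverse immaculate tableau $T^{\rho,M}_\alpha$ of shape $\alpha^r$ and content $\beta^\rho_\alpha$, and it is such that column $1$ contains the entries $\{1,2,\dots,\ell\}$ and every other cell is filled with $1$.
   Context: A composition $\alpha=(\alpha_1,\dots,\alpha_\ell)\vDash n$ is a finite list of positive integers with sum $n$; $\ell$ is its length; its reverse is $\alpha^r=(\alpha_\ell,\dots,\alpha_1)$. Lexicographic order on compositions of $n$: $\beta\le_l\alpha$ if $\beta=\alpha$ or $\beta_i<\alpha_i$ at the minimal index $i$ with $\beta_i\ne\alpha_i$. In the variables $x_1,x_2,\dots$, $M_\alpha=\sum_{i_1<\cdots<i_\ell}x_{i_1}^{\alpha_1}\cdots x_{i_\ell}^{\alpha_\ell}$; $\mathrm{QSym}^n$ is the $\mathbb{Z}$-span of $\{M_\alpha\mid\alpha\vDash n\}$, $\mathrm{QSym}=\bigoplus_{n\ge 0}\mathrm{QSym}^n$. The fundamental quasisymmetric functions are $F_\alpha=\sum_{\beta\preceq\alpha}M_\beta$, where $\beta\preceq\alpha$ means that the parts of $\alpha$ are obtained in order by adding adjacent parts of $\beta$;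 they form a basis. The linear map $\rho:\mathrm{QSym}\to\mathrm{QSym}$ is defined by $\rho(F_\alpha)=F_{\alpha^r}$. The diagram of $\alpha$ is the left-justified array of cells with $\alpha_i$ cells in row $i$, rows numbered from bottom to top, columns from left to right. The content of a filling by positive integers is the sequence $\beta$ with $\beta_i$ the number of entries equal to $i$. A semi-standard immaculate tableau of shape $\alpha$ is a filling of the diagram of $\alpha$ by positive integers with entries strictly increasing from bottom to top in the first column and weakly increasing from left to right in each row. A semi-standard reverse immaculate tableau of shape $\alpha$ is a filling with entries strictly increasing from bottom to top in the first (leftmost) column and weakly increasing from right to left in each row. The dual immaculate function is $\mathfrak{S}^*_\alpha=\sum_{\beta\vDash n}K_{\alpha,\beta}M_\beta$, with $K_{\alpha,\beta}$ the number of semi-standard immaculate tableaux of shape $\alpha$ and content $\beta$; $\{\mathfrak{S}^*_\alpha\}_{\alpha\vDash n}$ is a $\mathbb{Z}$-basis of $\mathrm{QSym}^n$. For a basis element $B$, $[B]G$ denotes the coefficient of $B$ in the expansion of $G$. The leading term of the expansion of a nonzero $G\in\mathrm{QSym}^n$ in a basis indexed by compositions of $n$ is the term with nonzero coefficient whose index is largest in lexicographic order. *)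

(* Defs.v *)
From HB Require Import structures.
From mathcomp Require Import all_boot all_order all_algebra finmap.
From mathcomp Require Import boolp classical_sets functions.

Set Implicit Arguments.
Unset Strict Implicit.
Unset Printing Implicit Defensive.

Import Order.TTheory GRing.Theory Num.Theory.

Local Open Scope ring_scope.

Definition is_comp (n : nat) (s : seq nat) : bool :=
  (0%N \notin s) && (sumn s == n).

Record compn (n : nat) := Comp { cval :> seq nat; _ : is_comp n cval }.

HB.instance Definition _ n := [isSub for @cval n].
HB.instance Definition _ n := [Choice of compn n by <:].
HB.instance Definition _ n := [Countable of compn n by <:].

Lemma compn_notin0 n (a : compn n) : 0%N \notin (a : seq nat).
Proof. by case: a => s /= /andP[]. Qed.

Lemma compn_sum n (a : compn n) : sumn a = n.
Proof. by case: a => s /= /andP[_ /eqP]. Qed.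

Lemma compn_eq_sum m n (b : compn m) (a : compn n) :
  (b : seq nat) = a -> m = n.
Proof. by move=> e; rewrite -(compn_sum b) e compn_sum. Qed.

Lemma size_le_sumn (s : seq nat) : 0%N \notin s -> (size s <= sumn s)%N.
Proof.
elim: s => //= x s IHs; rewrite inE negb_or => /andP[x0 /IHs h].
by rewrite -add1n leq_add // lt0n eq_sym.
Qed.

Lemma compn_size n (a : compn n) : (size a <= n)%N.
Proof. by rewrite -{2}(compn_sum a) size_le_sumn ?compn_notin0. Qed.

Lemma compn_le n (a : compn n) i : (nth 0%N a i <= n)%N.
Proof.
rewrite -{2}(compn_sum a); elim: (a : seq nat) i => [|x s IHs] [|i] //=.
  exact: leq_addr.
exact: leq_trans (IHs i) (leq_addl _ _).
Qed.

Definition compn_enc n (a : compn n) : {ffun 'I_n -> 'I_n.+1} :=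
  [ffun i : 'I_n => inord (nth 0%N a i)].

Definition compn_dec n (f : {ffun 'I_n -> 'I_n.+1}) : option (compn n) :=
  insub [seq x <- [seq nat_of_ord (f i) | i <- enum 'I_n] | x != 0%N].

Lemma compn_encK n : pcancel (@compn_enc n) (@compn_dec n).
Proof.
move=> a; rewrite /compn_dec.
have -> : [seq nat_of_ord (compn_enc a i) | i <- enum 'I_n]
          = [seq nth 0%N a i | i <- iota 0 n].
  rewrite -val_enum_ord -map_comp; apply: eq_map => i /=.
  by rewrite ffunE inordK // ltnS compn_le.
have -> : [seq x <- [seq nth 0%N a i | i <- iota 0 n] | x != 0%N] = a.
  have -> : iota 0 n = iota 0 (size a) ++ iota (size a) (n - size a).
    by rewrite -{2}[size a]add0n -iotaD subnKC // compn_size.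
  rewrite map_cat filter_cat.
  rewrite -/(mkseq _ _) mkseq_nth.
  have -> : [seq nth 0%N a i | i <- iota (size a) (n - size a)]
            = nseq (n - size a) 0%N.
    apply: (@eq_from_nth _ 0%N); first by rewrite size_map size_iota size_nseq.
    move=> i; rewrite size_map size_iota => hi.
    rewrite (nth_map 0%N) ?size_iota // nth_iota // nth_nseq hi.
    by rewrite nth_default // leq_addr.
  have -> : [seq x <- nseq (n - size a) 0%N | x != 0%N] = [::].
    by elim: (n - size a)%N.
  rewrite cats0; apply/all_filterP/allP => x xa.
  by apply: contraNneq (compn_notin0 a) => <-.
by rewrite valK.
Qed.

HB.instance Definition _ n : isFinite (compn n) :=
  PCanIsFinite (@compn_encK n).

Lemma crev_proof n (a : compn n) : is_comp n (rev a).
Proof. by rewrite /is_comp mem_rev compn_notin0 sumn_rev compn_sum eqxx. Qed.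

Definition crev n (a : compn n) : compn n := Comp (crev_proof a).

(** [refines b a]: grouping the parts of [b] into consecutive nonempty blocks
    of lengths [g] and adding up each block gives [a]. *)
Definition refines (b a : seq nat) : bool :=
  [exists g : compn (size b), [seq sumn r | r <- reshape g b] == a].

(** The library's lexicographic order on sequences makes a proper prefix
    smaller; this case does not occur between compositions of the same [n]. *)
Definition lexle (b a : seq nat) : bool := ((b : seqlexi nat) <= a)%O.

(** Power series over [int] in [x_0, x_1, ...], given by their coefficients;
    a monomial is given by its exponents. *)
Definition monom := {fsfun nat -> nat with 0%N}.
Definition pseries := monom -> int.

(** [x_{i_1} ^ a_1 * ... * x_{i_l} ^ a_l] *)
Definition xmon (i a : seq nat) : monom :=
  [fsfun k in [fset j in i]%fset => (\sum_(p <- zip i a | p.1 == k) p.2)%N].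

(** Distinct increasing sequences [i] give distinct monomials, since the parts
    of [a] are positive, so the coefficients of the sum of the [xmon i a]
    are 0 and 1. *)
Definition Mseries n (a : compn n) : pseries := fun m =>
  (`[< exists i : seq nat,
         [/\ size i = size a, sorted ltn i & m = xmon i a] >])%:R.

(** [QSym] is the Z-span of the [Mseries]. Z-modules are treated as abelian
    groups throughout: [x *~ k] is the integer multiple, and Z-linear maps are
    additive maps. *)
Definition qsym : {pred pseries} := fun f =>
  `[< exists N (c : forall n, compn n -> int),
        f = \sum_(n < N) \sum_(a : compn n) Mseries a *~ c n a >].

Lemma qsymP (f : pseries) :
  reflect (exists N (c : forall n, compn n -> int),
             (forall n, (N <= n)%N -> forall a : compn n, c n a = 0) /\
             forall N', (N <= N')%N ->
               f = \sum_(n < N') \sum_(a : compn n) Mseries a *~ c n a)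
          (f \in qsym).
Proof.
apply: (iffP (asboolP _)) => [[N [c ->]]|[N [c [_ h]]]]; last first.
  by exists N, c; exact: h.
exists N, (fun n a => if (n < N)%N then c n a else 0); split.
  by move=> n; rewrite leqNgt => /negbTE ->.
move=> N' leN.
rewrite (big_ord_widen N' (fun n => \sum_(a : compn n) Mseries a *~ c n a)) //.
rewrite big_mkcond; apply: eq_bigr => n _; case: ifP => // _.
by rewrite big1 // => a _; rewrite mulr0z.
Qed.

Lemma qsym_zmod_closed : zmod_closed qsym.
Proof.
split=> [|f g].
  by apply/asboolP; exists 0%N, (fun _ _ => 0); rewrite big_ord0.
move=> /qsymP[N1 [c1 [_ h1]]] /qsymP[N2 [c2 [_ h2]]].
apply/asboolP; exists (maxn N1 N2), (fun n a => c1 n a - c2 n a).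
rewrite {1}(h1 (maxn N1 N2)) ?leq_maxl // {1}(h2 (maxn N1 N2)) ?leq_maxr //.
rewrite -sumrB; apply: eq_bigr => n _; rewrite -sumrB.
by apply: eq_bigr => a _; rewrite mulrzBr.
Qed.

HB.instance Definition _ := GRing.isZmodClosed.Build pseries qsym
  qsym_zmod_closed.

Record QSym := MkQSym { qval :> pseries; _ : qval \in qsym }.

HB.instance Definition _ := [isSub for qval].
HB.instance Definition _ := [Choice of QSym by <:].
HB.instance Definition _ := [SubChoice_isSubZmodule of QSym by <:].

Lemma Mseries_qsym n (a : compn n) : Mseries a \in qsym.
Proof.
apply/asboolP.
exists n.+1, (fun m b => ((b : seq nat) == a)%:R).
rewrite big_ord_recr /= big1 ?add0r => [|m _].
  rewrite (bigD1 a) //= eqxx big1 ?addr0 // => b ba.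
  by rewrite -(inj_eq val_inj) /= in ba; rewrite (negbTE ba).
rewrite big1 // => b _; case: eqP => // eba.
by have := ltn_ord m; rewrite -[X in (_ < X)%N](compn_eq_sum eba) ltnn.
Qed.

Definition qM n (a : compn n) : QSym := MkQSym (Mseries_qsym a).

Definition qF n (a : compn n) : QSym := \sum_(b : compn n | refines b a) qM b.

Lemma refines_refl n (a : compn n) : refines a a.
Proof.
have H : is_comp (size a) (nseq (size a) 1%N).
  rewrite /is_comp sumn_nseq mul1n eqxx andbT.
  by apply/negP => /nseqP[].
apply/existsP; exists (Comp H) => /=; apply/eqP.
by elim: (a : seq nat) => //= x s IHs; rewrite take0 drop0 /= addn0 IHs.
Qed.

Lemma refines_size (b a : seq nat) :
  refines b a -> b != a -> (size a < size b)%N.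
Proof.
case/existsP=> g /eqP <-; apply: contraR.
rewrite size_map size_reshape -leqNgt => hs.
have {hs} : (size g == size b) by rewrite eqn_leq hs compn_size.
have := compn_notin0 g; have := compn_sum g.
move: (cval g) => {}g.
elim: g b => [|k g IHg] [|x b] //=.
rewrite inE eqSS negb_or => hsum /andP[k0 g0] /eqP hsz.
have hg := size_le_sumn g0.
have k1 : k = 1%N.
  apply/eqP; rewrite eqn_leq lt0n eq_sym k0 andbT.
  by rewrite -(leq_add2r (sumn g)) hsum add1n ltnS -hsz.
move: hsum; rewrite k1 add1n => -[hsum] /=.
rewrite take0 drop0 /= addn0 eqseq_cons eqxx /=.
by apply: IHg; rewrite ?hsz.
Qed.

Lemma refines_inv n (V : zmodType) (G : compn n -> V) :
  exists R : compn n -> V,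
    forall a : compn n, \sum_(b : compn n | refines b a) R b = G a.
Proof.
suff [R HR] : exists R : compn n -> V, forall a : compn n, (n - size a < n.+1)%N ->
    \sum_(b : compn n | refines b a) R b = G a.
  by exists R => a; apply: HR; rewrite ltnS leq_subr.
elim: n.+1 => [|k [R HR]]; first by exists (fun=> 0).
pose R' (a : compn n) := if (n - size a)%N == k
  then G a - \sum_(b : compn n | refines b a && (b != a)) R b else R a.
have R'E (a b : compn n) : refines b a -> b != a -> (n - size a <= k)%N ->
    R' b = R b.
  move=> ba neq ak; rewrite /R'; case: eqP => // bk.
  have := refines_size ba; rewrite (inj_eq val_inj) neq => /(_ isT) lt.
  have : (n - size b < n - size a)%N.
    by rewrite ltn_sub2l // (leq_trans lt) // compn_size.
  by rewrite bk ltnNge ak.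
exists R' => a; rewrite ltnS => ak.
rewrite (bigD1 a) ?refines_refl //=.
rewrite (eq_bigr R); last by move=> b /andP[ba nba]; exact: (R'E a).
rewrite {1}/R'; case: eqP => [_|/eqP nak]; first by rewrite subrK.
rewrite -(bigD1 a (P := fun b => refines b a)) ?refines_refl //=.
by apply: HR; rewrite ltn_neqAle nak.
Qed.

Definition packed (a : seq nat) : monom := xmon (iota 0 (size a)) a.

Lemma xmonE (i a : seq nat) j :
  sorted ltn i -> size i = size a -> (j < size i)%N ->
  xmon i a (nth 0%N i j) = nth 0%N a j.
Proof.
move=> si sz lt; rewrite /xmon fsfunE !inE mem_nth //.
have ui : uniq i by exact: (sorted_uniq ltn_trans ltnn si).
rewrite (big_nth (0%N, 0%N)) size_zip -sz minnn big_mkord.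
rewrite (bigD1 (Ordinal lt)) /= nth_zip //=.
rewrite big1 ?addn0 // => k /andP[]; rewrite nth_zip //= => /eqP e.
have := nth_uniq 0%N (ltn_ord k) lt ui; rewrite e eqxx.
by move=> /esym /eqP kj; rewrite -(inj_eq val_inj) /= kj eqxx.
Qed.

Lemma xmon_supp (i a : seq nat) k :
  0%N \notin a -> sorted ltn i -> size i = size a ->
  (xmon i a k != 0%N) = (k \in i).
Proof.
move=> a0 si sz; case: (boolP (k \in i)) => [ki|/negbTE ki].
  rewrite -(nth_index 0%N ki) xmonE ?index_mem //.
  apply: contraNneq a0 => <-; apply: mem_nth.
  by rewrite -sz index_mem.
by rewrite /xmon fsfunE !inE ki.
Qed.

Lemma Mseries_packed n m (b : compn n) (a : compn m) :
  Mseries b (packed a) = ((b : seq nat) == a)%:R.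
Proof.
rewrite /Mseries; congr (nat_of_bool _)%:R; apply/asboolP/eqP => [|eba].
  case=> i [szi si e].
  have ii : i = iota 0 (size a).
    apply: (irr_sorted_eq ltn_trans ltnn) => //; first exact: iota_ltn_sorted.
    move=> k; rewrite -(xmon_supp k (compn_notin0 b) si szi) -e.
    by rewrite xmon_supp ?compn_notin0 ?iota_ltn_sorted ?size_iota.
  have sab : size b = size a by rewrite -szi ii size_iota.
  apply: (@eq_from_nth _ 0%N) => // j hj.
  rewrite -(@xmonE i) ?szi // -e ii xmonE ?iota_ltn_sorted ?size_iota //.
  by rewrite -sab.
exists (iota 0 (size a)); split; rewrite ?size_iota ?eba //.
exact: iota_ltn_sorted.
Qed.

Definition Mcoef n (a : compn n) (f : QSym) : int := qval f (packed a).

Arguments Mcoef : simpl never.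

Lemma Mcoef_zmod_morphism n (a : compn n) : zmod_morphism (Mcoef a).
Proof. by move=> f g; rewrite /Mcoef -[qval]/val raddfB. Qed.

HB.instance Definition _ n (a : compn n) :=
  GRing.isZmodMorphism.Build QSym int (Mcoef a) (Mcoef_zmod_morphism a).

Lemma Mcoef_qM n m (a : compn n) (b : compn m) :
  Mcoef a (qM b) = ((b : seq nat) == a)%:R.
Proof. exact: Mseries_packed. Qed.

Lemma Mcoef_bound (f : QSym) :
  exists N, forall n, (N <= n)%N -> forall a : compn n, Mcoef a f = 0.
Proof.
have /asboolP[N [c fE]] := valP f; exists N => n le a.
have -> : f = \sum_(n < N) \sum_(b : compn n) qM b *~ c n b.
  apply: val_inj; rewrite raddf_sum [LHS]fE; apply: eq_bigr => m _.
  by rewrite raddf_sum; apply: eq_bigr => b _; rewrite raddfMz.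
rewrite raddf_sum big1 // => m _; rewrite raddf_sum big1 // => b _.
rewrite raddfMz [_ (qM b)]Mcoef_qM; case: eqP => [e|]; last by rewrite mul0rz.
by move: le; rewrite leqNgt -[X in (X < _)%N](compn_eq_sum e) ltn_ord.
Qed.

Section LinearExtension.
Variables (V : zmodType) (R : forall n, compn n -> V).

Definition Mext (f : QSym) : V :=
  \sum_(n < sval (cid (Mcoef_bound f))) \sum_(a : compn n) R a *~ Mcoef a f.

Lemma MextE f N :
  (forall n, (N <= n)%N -> forall a : compn n, Mcoef a f = 0) ->
  Mext f = \sum_(n < N) \sum_(a : compn n) R a *~ Mcoef a f.
Proof.
rewrite /Mext; case: cid => N' /= h' h.
pose G n := \sum_(a : compn n) R a *~ Mcoef a f.
suff H N1 N2 : (N1 <= N2)%N ->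
    (forall n, (N1 <= n)%N -> forall a : compn n, Mcoef a f = 0) ->
    \sum_(n < N1) G n = \sum_(n < N2) G n.
  by rewrite -!/(G _) (H N' (maxn N' N)) ?leq_maxl // (H N (maxn N' N)) ?leq_maxr.
move=> le h1; rewrite (big_ord_widen N2 G) // big_mkcond; apply: eq_bigr => n _.
case: ltnP => // len; rewrite /G big1 // => a _.
by rewrite h1 // mulr0z.
Qed.

Lemma Mext_zmod_morphism : zmod_morphism Mext.
Proof.
move=> f g; have [Nf hf] := Mcoef_bound f; have [Ng hg] := Mcoef_bound g.
have hf' n : (maxn Nf Ng <= n)%N -> forall a : compn n, Mcoef a f = 0.
  by rewrite geq_max => /andP[/hf].
have hg' n : (maxn Nf Ng <= n)%N -> forall a : compn n, Mcoef a g = 0.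
  by rewrite geq_max => /andP[_ /hg].
rewrite (MextE hf') (MextE hg') (MextE (N := maxn Nf Ng)); last first.
  by move=> n le a; rewrite raddfB [_ f]hf' // [_ g]hg' // subr0.
rewrite -sumrB; apply: eq_bigr => n _; rewrite -sumrB; apply: eq_bigr => a _.
have -> : Mcoef a (f - g) = Mcoef a f - Mcoef a g by exact: raddfB.
by rewrite mulrzBr.
Qed.

HB.instance Definition _ :=
  GRing.isZmodMorphism.Build QSym V Mext Mext_zmod_morphism.

Lemma Mext_qM n (a : compn n) : Mext (qM a) = R a.
Proof.
rewrite (MextE (N := n.+1)) => [|m le b]; last first.
  rewrite Mcoef_qM; case: eqP => // e.
  by move: le; rewrite (compn_eq_sum e) ltnn.
rewrite big_ord_recr /= [X in X + _]big1 ?add0r => [|m _].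
  rewrite (bigD1 a) //= Mcoef_qM eqxx big1 ?addr0 // => b ba.
  by rewrite Mcoef_qM eq_sym (inj_eq val_inj) (negbTE ba) mulr0z.
rewrite big1 // => b _; rewrite Mcoef_qM; case: eqP => // e.
by have := ltn_ord m; rewrite -[X in (X < _)%N](compn_eq_sum e) ltnn.
Qed.

End LinearExtension.

Lemma rho_exists : exists r : {additive QSym -> QSym},
  forall n (a : compn n), r (qF a) = qF (crev a).
Proof.
pose H n := cid (refines_inv (fun a : compn n => qF (crev a))).
exists (Mext (fun n => sval (H n))) => n a.
rewrite /qF raddf_sum (eq_bigr (sval (H n))) => [|b _]; last exact: Mext_qM.
exact: (svalP (H n) a).
Qed.

(** The functions [qF a] span [QSym], so [rho_qF] determines [rho]. *)
Definition rho : {additive QSym -> QSym} := sval (cid rho_exists).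

Lemma rho_qF n (a : compn n) : rho (qF a) = qF (crev a).
Proof. exact: (svalP (cid rho_exists)). Qed.

(** A filling is given by its rows from bottom to top, each row being read from
    left to right. Its shape is the library's [shape]. *)
Definition filling := seq (seq nat).

Definition is_filling (a : seq nat) (T : filling) : bool :=
  (shape T == a) && (0%N \notin flatten T).

Definition content (T : filling) : seq nat :=
  mkseq (fun i => count_mem i.+1 (flatten T)) (\max_(x <- flatten T) x)%N.

Definition column1 (T : filling) : seq nat := [seq head 0%N r | r <- T].

Definition ssit (a : seq nat) (T : filling) : bool :=
  [&& is_filling a T, sorted ltn (column1 T) & all (sorted leq) T].

Definition ssrit (a : seq nat) (T : filling) : bool :=
  [&& is_filling a T, sorted ltn (column1 T) & all (sorted geq) T].

(** Fillings of shape [a] are counted through their reading words [w]; a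
    filling with content [b], a composition of [n], has no entry above [n]. *)
Definition kostka n (a b : compn n) : nat :=
  #|[set w : n.-tuple 'I_n.+1 |
      let T := reshape a [seq nat_of_ord x | x <- w] in
      ssit a T && (content T == b)]|.

Definition dualImm n (a : compn n) : QSym :=
  \sum_(b : compn n) qM b *+ kostka a b.

(** The coefficient [[B_b] G], meaningful when [G] has a unique expansion in
    the family [B]; it is 0 when [G] has no expansion. *)
Definition bcoef n (B : compn n -> QSym) (G : QSym) (b : compn n) : int :=
  xget 0 [set c : {ffun compn n -> int} | G = \sum_(d : compn n) B d *~ c d] b.

Definition leading_index n (B : compn n -> QSym) (G : QSym) (b : compn n) :
    Prop :=
  bcoef B G b != 0 /\ (forall d : compn n, bcoef B G d != 0 -> lexle d b).

Lemma hook_rho_proof n (a : compn n) : (0 < n)%N ->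
  is_comp n ((n - size a).+1 :: nseq (size a).-1 1%N).
Proof.
move=> n0; have sa := compn_size a.
have sa0 : (0 < size a)%N.
  by case: a {sa} => -[|//] /=; rewrite /is_comp /= => /eqP e; rewrite -e in n0.
rewrite /is_comp inE negb_or /= sumn_nseq mul1n; apply/andP; split.
  by apply/negP => /nseqP[].
by rewrite addSn -addnS prednK // subnK.
Qed.

Definition hook_rho n (a : compn n) (n0 : (0 < n)%N) : compn n :=
  Comp (hook_rho_proof a n0).

(* Main.v *)
Require Import Defs.
From mathcomp Require Import all_boot all_order all_algebra.
From mathcomp Require Import classical_sets.
From mathcomp Require Import zify.

(** The statement about [rho] becomes one about Kostka numbers in two steps.

    First, reversing compositions commutes with refinement, so [rho], which is
    given on the [qF], also sends each [qM a] to [qM (crev a)] ([rho_qM]).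
    Hence the coefficient of [qM b] in [rho (dualImm alpha)] is
    [kostka alpha (crev b)] ([rho_dualImm]).

    Second, the dual immaculate functions are unitriangular over the [qM]:
    [kostka a b] vanishes unless [b] is lexicographically at most [a]
    ([kostka_lexle]), and [kostka a a] is 1 ([kostka_diag]). In both cases the
    reason is that an entry of row [i], counted from 1, is at least [i], so that
    the entries up to [k] have to fit into the bottom [k] rows. For any
    unitriangular family the leading term of an expansion has the same index
    and the same coefficient as the leading term over the [qM]
    ([unitri_leading]).

    It remains to find the largest [b] with [kostka alpha (crev b)] nonzero.
    A strictly increasing first column of length [l] needs [l] distinct
    entries, so [b] has at least [l] parts ([kostka_size]), and the largest such
    composition of [n] is the hook [(n - l + 1, 1, ..., 1)] ([lexle_hook_rho]).
    A filling with exactly [l] different entries and strictly increasing first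
    column has the first column [1, ..., l]. If in addition all the entries
    except [m] occur once, then the other cells all contain [m]
    ([hook_filling_uniq]). For [m = l] the rows weakly increase from left to
    right: this is the one immaculate tableau whose content is the reversed
    hook, so the leading coefficient is 1. For [m = 1] the rows weakly increase
    from right to left: this is the reverse immaculate tableau whose content is
    the hook. *)

Set Implicit Arguments.
Unset Strict Implicit.
Unset Printing Implicit Defensive.

Import Order.TTheory GRing.Theory.

Local Open Scope ring_scope.

(** * Contents of fillings *)

Lemma nth_content (T : filling) i :
  nth 0%N (content T) i = count_mem i.+1 (flatten T).
Proof.
rewrite /content; case: (ltnP i (\max_(x <- flatten T) x)%N) => hi.
  by rewrite nth_mkseq.
rewrite nth_default ?size_mkseq //; apply/esym/count_memPn.
apply: contraL hi => hi; rewrite -ltnNge.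
exact: (leq_bigmax_seq (F := id)).
Qed.

Lemma entry_le_size_content (T : filling) x :
  x \in flatten T -> (x <= size (content T))%N.
Proof. by rewrite size_mkseq => hx; exact: (leq_bigmax_seq (F := id)). Qed.

(** Since the parts of a composition are positive, its last part forces the
    largest entry of [T] to be the number of parts. *)
Lemma contentP n (b : compn n) (T : filling) : 0%N \notin flatten T ->
  content T = b <-> (forall i, nth 0%N b i = count_mem i.+1 (flatten T)).
Proof.
move=> T0; split=> [<- i|h]; first exact: nth_content.
suff sz : size (content T) = size b.
  by apply: (@eq_from_nth _ 0%N) => // i _; rewrite nth_content h.
rewrite size_mkseq; apply/eqP; rewrite eqn_leq; apply/andP; split.
  apply/bigmax_leqP_seq => -[//|x] xT _; rewrite ltnNge.
  apply/negP => le; move: (h x); rewrite nth_default // => /esym/count_memPn.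
  by rewrite xT.
case e : (size b) => [//|k].
have : nth 0%N b k != 0%N.
  by apply: contraNneq (compn_notin0 b) => <-; apply: mem_nth; rewrite e.
rewrite h -lt0n -has_count has_pred1 => hk.
exact: (leq_bigmax_seq (F := id)).
Qed.

Lemma column1_sub_flatten (T : filling) : 0%N \notin shape T ->
  {subset column1 T <= flatten T}.
Proof.
elim: T => [|[|x r] T IHT] //=; rewrite inE /= => hT y.
rewrite !inE mem_cat => /orP[->//|yT].
by rewrite (IHT _ y yT) ?orbT.
Qed.

Lemma count_column1 (T : filling) (p : pred nat) : 0%N \notin shape T ->
  count p (flatten T)
    = (count p (column1 T) + count p (flatten [seq behead r | r <- T]))%N.
Proof.
elim: T => [|[|x r] T IHT] //=; rewrite inE /= => hT.
by rewrite !count_cat IHT //; lia.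
Qed.

Lemma size_flatten_behead (T : filling) : 0%N \notin shape T ->
  (size (flatten [seq behead r | r <- T]) + size T = sumn (shape T))%N.
Proof.
elim: T => [|[|x r] T IHT] //=; rewrite inE /= => hT.
by rewrite size_cat -IHT //; lia.
Qed.

(** * Fillings with hook content *)

(** Both tableaux of the proof have this form: [m] is [size a] for the immaculate
    and 1 for the reverse immaculate one. *)
Definition hook_filling (m : nat) (a : seq nat) : filling :=
  [seq i.+1 :: nseq (nth 0%N a i).-1 m | i <- iota 0 (size a)].

Lemma column1_hook_filling m a : column1 (hook_filling m a) = iota 1 (size a).
Proof.
by rewrite /column1 /hook_filling -map_comp -[1%N]addn0 iotaDl; apply: eq_map.
Qed.

Lemma behead_hook_filling m a r x :
  r \in hook_filling m a -> x \in behead r -> x = m.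
Proof. by case/mapP=> i _ -> /= /nseqP[]. Qed.

Lemma shape_hook_filling m a : 0%N \notin a -> shape (hook_filling m a) = a.
Proof.
move=> a0; rewrite /shape -map_comp -[RHS](mkseq_nth 0%N).
apply/eq_in_map => i; rewrite mem_iota /= size_nseq => hi.
by rewrite prednK // lt0n; apply: contraNneq a0 => <-; exact: mem_nth.
Qed.

(** The content [b] has [size a] parts, all equal to 1 except that the [m]-th
    one absorbs the remaining [n - size a] cells. *)
Section HookContent.
Variables (n : nat) (a b : compn n) (m : nat).
Hypothesis m_pos : (0 < m)%N.
Hypothesis m_le : (m <= size a)%N.
Hypothesis b_nth : forall i,
  nth 0%N b i = ((i < size a) + (i.+1 == m) * (n - size a))%N.

Lemma hook_filling_is_filling : is_filling a (hook_filling m a).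
Proof.
rewrite /is_filling shape_hook_filling ?compn_notin0 // eqxx /=.
apply/negP => /flattenP[r /mapP[i _ ->]]; rewrite inE /= => /nseqP[m0 _].
by move: m_pos; rewrite -m0.
Qed.

Lemma hook_filling_content : content (hook_filling m a) = b.
Proof.
have /andP[/eqP sh T0] := hook_filling_is_filling.
have sh0 : 0%N \notin shape (hook_filling m a) by rewrite sh compn_notin0.
apply/contentP => // i; rewrite count_column1 // column1_hook_filling.
rewrite b_nth count_uniq_mem ?iota_uniq // mem_iota; congr (_ + _)%N.
have /all_pred1P-> : all (pred1 m)
    (flatten [seq behead r | r <- hook_filling m a]).
  apply/allP => x /flattenP[r /mapP[r' hr' ->] xr]; apply/eqP.
  exact: behead_hook_filling hr' xr.
have := size_flatten_behead sh0; rewrite sh compn_sum size_map size_iota => sz.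
by rewrite count_nseq /= eq_sym; congr (_ * _)%N; lia.
Qed.

(** The entries of [T] are at most [size a], which is also the number of cells
    in the first column, so the first column is [1, 2, ...]; this uses up all
    the entries but [n - size a] copies of [m]. *)
Lemma hook_filling_uniq (T : filling) :
  is_filling a T -> sorted ltn (column1 T) -> content T = b ->
  T = hook_filling m a.
Proof.
move=> /andP[/eqP sh T0] srt /(contentP b T0) cT.
have sh0 : 0%N \notin shape T by rewrite sh compn_notin0.
have szT : size T = size a by rewrite -sh size_map.
have sub : {subset column1 T <= iota 1 (size a)}.
  move=> [|x] /(column1_sub_flatten sh0) xT; first by rewrite xT in T0.
  have : count_mem x.+1 (flatten T) != 0%N.
    by rewrite -lt0n -has_count has_pred1.
  by rewrite -cT b_nth mem_iota; lia.
have c1 : column1 T = iota 1 (size a).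
  apply: (irr_sorted_eq ltn_trans ltnn) => //; first exact: iota_ltn_sorted.
  have ltl : (size (iota 1 (size a)) <= size (column1 T))%N.
    by rewrite size_iota size_map szT.
  by have [] := uniq_min_size (sorted_uniq ltn_trans ltnn srt) sub ltl.
have hb : all (pred1 m) (flatten [seq behead r | r <- T]).
  apply/allP => -[|x] xT.
    case/negP: T0; rewrite -has_pred1 has_count count_column1 //.
    by rewrite addn_gt0 -!has_count !has_pred1 xT orbT.
  have : count_mem x.+1 (flatten [seq behead r | r <- T]) != 0%N.
    by rewrite -lt0n -has_count has_pred1.
  have := count_column1 (pred1 x.+1) sh0.
  rewrite -cT b_nth c1 -[count _ (iota _ _)]/(count_mem x.+1 _).
  rewrite (count_uniq_mem _ (iota_uniq _ _)) mem_iota /=.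
  by lia.
apply: (@eq_from_nth _ [::]) => [|i hi]; first by rewrite size_map size_iota.
rewrite szT in hi.
rewrite (nth_map 0%N) ?size_iota // nth_iota // add0n -sh.
rewrite (nth_map [::]) ?szT //.
have hT : nth [::] T i \in T by rewrite mem_nth ?szT.
have : head 0%N (nth [::] T i) = i.+1.
  have := congr1 (fun s => nth 0%N s i) c1.
  by rewrite (nth_map [::]) ?szT // nth_iota // add1n.
have : all (pred1 m) (behead (nth [::] T i)).
  apply/allP => x xr; apply: (allP hb); apply/flattenP.
  by exists (behead (nth [::] T i)) => //; exact: map_f.
case: (nth _ _ _) => [|x r] //= /all_pred1P rE ->.
by rewrite {1}rE.
Qed.

End HookContent.

(** * Kostka numbers *)

Lemma kostka_gt0 n (a b : compn n) : kostka a b != 0%N ->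
  exists2 T : filling, ssit a T & content T = b.
Proof.
rewrite /kostka cards_eq0 => /set0Pn[w]; rewrite inE => /andP[h /eqP c].
by eexists; first exact: h.
Qed.

(** A filling is determined by its shape and its reading word, so the uniqueness
    of the tableau makes the counted set of words a singleton. *)
Lemma kostka_eq1 n (a b : compn n) (T : filling) :
  ssit a T -> content T = b ->
  (forall T', ssit a T' -> content T' = b -> T' = T) -> kostka a b = 1%N.
Proof.
move=> aT bT uT.
have /and3P[/andP[/eqP sh T0] _ _] := aT.
have szT : size (flatten T) == n by rewrite size_flatten sh compn_sum.
have leT x : x \in flatten T -> (x < n.+1)%N.
  move=> /entry_le_size_content; rewrite bT ltnS => /leq_trans; apply.
  exact: compn_size.
pose w0 : n.-tuple 'I_n.+1 := map_tuple inord (Tuple szT).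
have w0E : [seq nat_of_ord x | x <- w0] = flatten T.
  rewrite /= -map_comp -[RHS]map_id; apply/eq_in_map => x xT /=.
  by rewrite inordK // leT.
apply/eqP/cards1P; exists w0; apply/setP => w; rewrite !inE.
apply/idP/eqP => [/andP[h /eqP c]|->]; last first.
  by rewrite w0E; have := flattenK T; rewrite sh => -> /=; rewrite aT bT eqxx.
apply/val_inj/(inj_map val_inj) => /=.
rewrite -[RHS]/([seq nat_of_ord x | x <- w0]) w0E -(uT _ h c).
by rewrite reshapeKr // size_map size_tuple compn_sum.
Qed.

(** * Triangularity of the Kostka numbers *)

Lemma lexle_cons x y (s t : seq nat) :
  lexle (x :: s) (y :: t) = (x <= y)%N && ((y <= x)%N ==> lexle s t).
Proof. by rewrite /lexle lexi_cons !leEnat. Qed.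

Lemma path_ltn_succ k x s : (k < x)%N -> path ltn x s -> path ltn k.+1 s.
Proof.
by rewrite leq_eqVlt => /orP[/eqP->|/(path_le ltn_trans)]//; apply.
Qed.

(** The first column bounds the entries of each row from below, and it
    increases. *)
Lemma column1_lt_entries k (T : filling) :
  0%N \notin shape T -> path ltn k (column1 T) -> all (sorted leq) T ->
  all (fun x => k < x)%N (flatten T).
Proof.
elim: T k => [|[|x r] T IHT] k //=; rewrite inE /= => sh0 /andP[kx pT].
move=> /andP[sr sT]; rewrite kx all_cat /=; apply/andP; split.
  apply: (sub_all _ (order_path_min leq_trans sr)) => y.
  exact: leq_trans.
by apply: (sub_all _ (IHT k.+1 sh0 (path_ltn_succ kx pT) sT)) => y; exact: ltnW.
Qed.

(** The tableau with [shape = content], with all the values shifted up by [k]: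
    each row is constant. The shift makes the recursion on the rows work. *)
Fixpoint row_filling (k : nat) (a : seq nat) : filling :=
  if a is x :: a' then nseq x k.+1 :: row_filling k.+1 a' else [::].

Lemma shape_row_filling k a : shape (row_filling k a) = a.
Proof. by elim: a k => //= x a IHa k; rewrite size_nseq IHa. Qed.

Lemma path_column1_row_filling k a : 0%N \notin a ->
  path ltn k (column1 (row_filling k a)).
Proof.
elim: a k => [|[|x] a IHa] k //=; rewrite inE /= => a0.
by rewrite ltnSn IHa.
Qed.

Lemma row_filling_sorted k a : all (sorted leq) (row_filling k a).
Proof.
elim: a k => //= x a IHa k; rewrite IHa andbT.
by case: x => //= x; elim: x => //= x ->; rewrite leqnn.
Qed.

Lemma count_row_filling k a i : 0%N \notin a ->
  count_mem (k + i).+1 (flatten (row_filling k a)) = nth 0%N a i.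
Proof.
elim: a k i => [|x a IHa] k i /=; first by rewrite nth_nil.
rewrite inE negb_or => /andP[_ a0]; rewrite count_cat count_nseq /=.
case: i => [|i] /=; last first.
  rewrite addnS -addSn IHa //; suff -> : (k.+1 == (k.+1 + i).+1) = false by [].
  by lia.
rewrite addn0 eqxx mul1n (count_memPn _) ?addn0 //.
have := column1_lt_entries _ (path_column1_row_filling k.+1 a0)
          (row_filling_sorted _ _).
rewrite shape_row_filling => /(_ a0) /allP h.
by apply/negP => /h; rewrite ltnn.
Qed.

(** The value [k.+1] is smaller than every first-column entry above the bottom
    row, hence occurs in the bottom row only. Either it leaves room in that row
    and the first part of the content drops, or it fills that row and the
    remaining rows are in the same situation with [k.+1] in place of [k]. *)
Lemma content_lexle k (T : filling) (b : seq nat) :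
  0%N \notin b -> 0%N \notin shape T ->
  path ltn k (column1 T) -> all (sorted leq) T ->
  (forall i, nth 0%N b i = count_mem (k + i).+1 (flatten T)) ->
  lexle b (shape T) /\ (b = shape T -> T = row_filling k b).
Proof.
elim: T k b => [|r T IHT] k [|y b] //.
  (* Without rows there are no entries, so a first part of [b] would be 0. *)
  by move=> + _ _ _ /(_ 0%N) /= y0; rewrite inE /= y0.
rewrite !inE !negb_or /= => /andP[_ b0] /andP[r0 sh0] /andP[kr pT].
move=> /andP[sr sT] h.
have {}pT := path_ltn_succ kr pT.
have nT : k.+1 \notin flatten T.
  apply/negP; have /allP hT := column1_lt_entries sh0 pT sT.
  by move/hT; rewrite ltnn.
have yE : y = count_mem k.+1 r.
  by have := h 0%N; rewrite /= addn0 count_cat (count_memPn nT) addn0.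
have rE : (size r <= y)%N -> r = nseq (size r) k.+1.
  rewrite yE => le; apply/all_pred1P; rewrite all_count eqn_leq count_size.
  exact: le.
have hb : (size r <= y)%N ->
    forall i, nth 0%N b i = count_mem (k.+1 + i).+1 (flatten T).
  move=> /rE {}rE i; have := h i.+1.
  rewrite /= rE count_cat count_nseq /= addnS -addSn => ->.
  by suff -> : (k.+1 == (k.+1 + i).+1) = false by []; lia.
split.
  rewrite lexle_cons yE count_size /= -yE; apply/implyP => le.
  by case: (IHT k.+1 b) => //; exact: hb.
case=> yr bT; have le : (size r <= y)%N by rewrite yr.
case: (IHT k.+1 b) => //; first exact: hb.
by move=> _ /(_ bT) {1}->; rewrite yr -rE.
Qed.

Lemma path_ltn0_column1 (T : filling) :
  0%N \notin flatten T -> 0%N \notin shape T -> sorted ltn (column1 T) ->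
  path ltn 0 (column1 T).
Proof.
case: T => [|[|x r] T] //; rewrite /= inE negb_or eq_sym -lt0n => /andP[x0 _].
by move=> _ ->; rewrite x0.
Qed.

Lemma kostka_lexle n (a b : compn n) : kostka a b != 0%N -> lexle b a.
Proof.
case/kostka_gt0 => T /and3P[/andP[/eqP sh T0] srt rows] /(contentP b T0) cT.
have sh0 : 0%N \notin shape T by rewrite sh compn_notin0.
have p0 := path_ltn0_column1 T0 sh0 srt.
have [] := content_lexle (compn_notin0 b) sh0 p0 rows.
  by move=> i; rewrite cT.
by rewrite sh.
Qed.

Lemma kostka_diag n (a : compn n) : kostka a a = 1%N.
Proof.
have a0 := compn_notin0 a.
have rf0 : 0%N \notin flatten (row_filling 0 a).
  have := column1_lt_entries _ (path_column1_row_filling 0 a0)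
            (row_filling_sorted _ _).
  by rewrite shape_row_filling => /(_ a0) /allP h; apply/negP => /h.
apply: (@kostka_eq1 _ _ _ (row_filling 0 a)) => [||T].
- rewrite /ssit /is_filling shape_row_filling eqxx rf0.
  rewrite row_filling_sorted !andbT.
  exact: path_sorted (path_column1_row_filling 0 a0).
- by apply/contentP => // i; rewrite -(count_row_filling 0).
move=> /and3P[/andP[/eqP sh T0] srt rows] /(contentP a T0) cT.
have sh0 : 0%N \notin shape T by rewrite sh compn_notin0.
have [] := content_lexle a0 sh0 (path_ltn0_column1 T0 sh0 srt) rows.
  by move=> i; rewrite cT.
by rewrite sh => _; apply.
Qed.

(** The entries of the first column are distinct values between 1 and the
    number of parts of the content. *)
Lemma kostka_size n (a b : compn n) : kostka a b != 0%N -> (size a <= size b)%N.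
Proof.
case/kostka_gt0 => T /and3P[/andP[/eqP sh T0] srt _] cT.
have sh0 : 0%N \notin shape T by rewrite sh compn_notin0.
rewrite -sh size_map -(size_map (head 0%N)) -(size_iota 1 (size b)).
apply: uniq_leq_size => [|x /(column1_sub_flatten sh0) xT].
  exact: (sorted_uniq ltn_trans ltnn srt).
rewrite mem_iota add1n ltnS -cT (entry_le_size_content xT) andbT lt0n.
by apply: contraNneq T0 => <-.
Qed.

(** * The map rho reverses monomial quasisymmetric functions *)

Lemma crevK n : involutive (@crev n).
Proof. by move=> a; apply: val_inj; rewrite /= revK. Qed.

Lemma refines_rev n (a b : compn n) :
  refines b a -> refines (crev b) (crev a).
Proof.
case/existsP=> g /eqP gE.
have hg : is_comp (size (crev b)) (rev g).
  by rewrite /is_comp mem_rev compn_notin0 sumn_rev compn_sum /= size_rev eqxx.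
apply/existsP; exists (Comp hg); apply/eqP; rewrite /= -gE -map_rev.
rewrite rev_reshape ?compn_sum // -map_comp; apply: eq_map => r.
by rewrite /= sumn_rev.
Qed.

(** Reversal commutes with refinement, so the triangular system defining the
    [F] in terms of the [M] is invariant under reversing all compositions. *)
Lemma rho_qM n (a : compn n) : rho (qM a) = qM (crev a).
Proof.
have [k] := ubnP (n - size a)%N; elim: k a => // k IHk a; rewrite ltnS => ak.
have qME (c : compn n) :
    qM c = qF c - \sum_(b : compn n | refines b c && (b != c)) qM b.
  by rewrite /qF (bigD1 c) ?refines_refl //= addrK.
rewrite qME raddfB /= rho_qF raddf_sum /= [RHS]qME; congr (_ - _).
rewrite [RHS](reindex_inj (inv_inj (@crevK n))).
apply: eq_big => [b|b /andP[ba nba]].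
  rewrite (inj_eq (inv_inj (@crevK n))); congr andb.
  by apply/idP/idP => /refines_rev; rewrite ?crevK.
apply: IHk; apply: leq_trans ak.
have := refines_size ba; rewrite (inj_eq val_inj) nba => /(_ isT) lt.
by have := compn_size b; lia.
Qed.

(** * Leading terms of expansions in unitriangular families *)

Lemma lexle_anti n (a b : compn n) : lexle a b -> lexle b a -> a = b.
Proof.
by move=> ab ba; apply/val_inj/(@le_anti _ (seqlexi nat))/andP.
Qed.

Section Unitriangular.
Variables (n : nat) (B : compn n -> QSym).
Hypothesis B_diag : forall a, Mcoef a (B a) = 1.
Hypothesis B_tri : forall a b : compn n, Mcoef b (B a) != 0 -> lexle b a.
Hypothesis B_span : forall a, B a = \sum_(b : compn n) qM b *~ Mcoef b (B a).

Let expands (G : QSym) :=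
  exists c : {ffun compn n -> int}, G = \sum_(d : compn n) B d *~ c d.

Let expands_sum (P : pred (compn n)) (F : compn n -> QSym)
    (k : compn n -> int) :
  (forall b, P b -> expands (F b)) -> expands (\sum_(b | P b) F b *~ k b).
Proof.
move=> hF; apply: (big_ind expands).
- by exists [ffun=> 0]; rewrite big1 // => d _; rewrite ffunE mulr0z.
- move=> G H [c ->] [d ->]; exists [ffun x => c x + d x].
  by rewrite -big_split; apply: eq_bigr => x _; rewrite ffunE mulrzDr.
- move=> b /hF[c ->]; exists [ffun x => c x * k b].
  rewrite mulrz_suml; apply: eq_bigr => x _.
  by rewrite ffunE mulrzA.
Qed.

(** By induction on the number of compositions up to [a]: besides [qM a], the
    [M]-expansion of [B a] involves only [qM b] with smaller [b], so that it can
    be solved for [qM a]. *)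
Let expands_qM (a : compn n) : expands (qM a).
Proof.
pose rank (d : compn n) := #|[set e : compn n | lexle e d]|.
have [k] := ubnP (rank a); elim: k a => // k IHk a; rewrite ltnS => ak.
have -> : qM a = \sum_(d | d == a) B d *~ 1
    - \sum_(b | (b != a) && (Mcoef b (B a) != 0)) qM b *~ Mcoef b (B a).
  rewrite big_pred1_eq [X in _ = X *~ _ - _]B_span (bigD1 a) //= B_diag.
  rewrite !mulr1z [X in _ + X - _](bigID (fun b => Mcoef b (B a) != 0)) /=.
  rewrite [X in _ + (_ + X) - _]big1 ?addr0 ?addrK // => b.
  by rewrite negbK => /andP[_ /eqP->]; rewrite mulr0z.
have [c hc] : expands (\sum_(b | (b != a) && (Mcoef b (B a) != 0))
                         qM b *~ Mcoef b (B a)).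
  apply: expands_sum => b /andP[nba /B_tri ba]; apply: IHk.
  apply: leq_trans ak; apply: proper_card; apply/properP; split.
    apply/fintype.subsetP => e; rewrite !inE => eb.
    exact: (@le_trans _ (seqlexi nat) _ _ _ eb ba).
  exists a; rewrite inE; first exact: (@lexx _ (seqlexi nat)).
  by apply: contra nba => ab; apply/eqP; exact: lexle_anti.
exists [ffun d => (d == a)%:R - c d].
rewrite hc big_mkcond -sumrB; apply: eq_bigr => d _.
by rewrite ffunE mulrzBr; case: eqP.
Qed.

(** If [d] is the largest index in a [B]-expansion of [G], only [B d]
    contributes to [M d]; so the largest indices of [G] in the [B]- and
    [M]-expansions agree, and so do the coefficients there. *)
Lemma unitri_leading (G : QSym) (b : compn n) :
  G = \sum_(d : compn n) qM d *~ Mcoef d G ->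
  Mcoef b G != 0 -> (forall d : compn n, Mcoef d G != 0 -> lexle d b) ->
  leading_index B G b /\ bcoef B G b = Mcoef b G.
Proof.
move=> GE Gb0 Gb.
have : expands G by rewrite GE; apply: expands_sum => d _; exact: expands_qM.
move/(xgetPex 0); rewrite /leading_index /bcoef.
move: (xget _ _) => c /= cE.
(* Nothing above [e] occurs in the expansion, so only [B e] contributes. *)
have McE (e : compn n) : (forall d, c d != 0 -> lexle d e) -> Mcoef e G = c e.
  move=> ce; rewrite {1}cE raddf_sum (bigD1 e) //= raddfMz /= B_diag.
  rewrite big1 ?addr0 ?intz // => d nde; rewrite raddfMz /=.
  have [->|/ce de] := eqVneq (c d) 0; first by rewrite mulr0z.
  have [->|/B_tri ed] := eqVneq (Mcoef e (B d)) 0; first by rewrite mul0rz.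
  by rewrite (lexle_anti de ed) eqxx in nde.
have cb d : c d != 0 -> lexle d b.
  move=> cd.
  have [e ce emax] : exists2 e, c e != 0 & forall d, c d != 0 -> lexle d e.
    case: (@arg_maxP _ _ _ d (fun d => c d != 0)
            (fun d : compn n => (d : seqlexi nat)) cd) => e ce emax.
    by exists e => // d' /emax.
  apply: (@le_trans _ (seqlexi nat) _ _ _ (emax _ cd)); apply: Gb.
  by rewrite McE.
by rewrite -(McE _ cb).
Qed.

End Unitriangular.

(** * The dual immaculate functions and their images under rho *)

Lemma Mcoef_sum_qM n (k : compn n -> nat) (a : compn n) :
  Mcoef a (\sum_(b : compn n) qM b *+ k b) = (k a)%:R.
Proof.
rewrite raddf_sum (bigD1 a) //= raddfMn /= Mcoef_qM eqxx big1 ?addr0 //.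
by move=> b ba; rewrite raddfMn /= Mcoef_qM (inj_eq val_inj) (negbTE ba) mul0rn.
Qed.

Lemma sum_qM_expand n (k : compn n -> nat) (G : QSym) :
  G = \sum_(b : compn n) qM b *+ k b ->
  G = \sum_(b : compn n) qM b *~ Mcoef b G.
Proof.
move=> GE; rewrite {1}GE; apply: eq_bigr => b _.
by rewrite GE Mcoef_sum_qM pmulrn natz.
Qed.

Lemma rho_dualImm n (a : compn n) :
  rho (dualImm a) = \sum_(b : compn n) qM b *+ kostka a (crev b).
Proof.
rewrite /dualImm raddf_sum [RHS](reindex_inj (inv_inj (@crevK n))) /=.
by apply: eq_bigr => b _; rewrite raddfMn /= rho_qM crevK.
Qed.

(** * The hook composition *)

Lemma compn_size_gt0 n (a : compn n) : (0 < n)%N -> (0 < size a)%N.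
Proof. by have := compn_sum a; case: (cval a) => //= <-. Qed.

Lemma sumn_le_size_nseq (s : seq nat) : 0%N \notin s -> (sumn s <= size s)%N ->
  s = nseq (size s) 1%N.
Proof.
elim: s => //= x s IHs; rewrite inE negb_or => /andP[x0 s0].
have := size_le_sumn s0 => le le'.
by rewrite -IHs //; [congr cons; lia | lia].
Qed.

(** With at least [size a] parts, the first part of [b] is at most that of the
    hook, and in case of equality only ones can follow. *)
Lemma lexle_hook_rho n (a b : compn n) (n0 : (0 < n)%N) :
  (size a <= size b)%N -> lexle b (hook_rho a n0).
Proof.
have := compn_size_gt0 a n0; have := compn_size a.
have := compn_sum b; have := compn_notin0 b; rewrite /=.
case: (cval b) => [|x s] //; rewrite inE negb_or /= => /andP[_ s0] xs an a0 ab.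
have ss := size_le_sumn s0.
rewrite lexle_cons; apply/andP; split; first by lia.
apply/implyP => le; rewrite (sumn_le_size_nseq s0); last by lia.
suff -> : size s = (size a).-1 by exact: (@lexx _ (seqlexi nat)).
by lia.
Qed.

Lemma nth_hook_rho n (a : compn n) (n0 : (0 < n)%N) i :
  nth 0%N (hook_rho a n0) i
    = ((i < size a) + (i.+1 == 1) * (n - size a))%N.
Proof.
have := compn_size_gt0 a n0; case: i => [|i] /= a0.
  by rewrite a0 mul1n.
by rewrite nth_nseq addn0 -(ltn_add2r 1) !addn1 prednK //.
Qed.

Lemma nth_crev_hook_rho n (a : compn n) (n0 : (0 < n)%N) i :
  nth 0%N (crev (hook_rho a n0)) i
    = ((i < size a) + (i.+1 == size a) * (n - size a))%N.
Proof.
have a0 := compn_size_gt0 a n0.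
rewrite /= rev_cons rev_nseq nth_rcons size_nseq nth_nseq.
by case: (ltngtP i (size a).-1) => hi; lia.
Qed.

Lemma all_sorted_hook_filling (r : rel nat) m a : reflexive r ->
  (forall i, (i < size a)%N -> r i.+1 m) -> all (sorted r) (hook_filling m a).
Proof.
move=> rr h; apply/allP => _ /mapP[i hi ->] /=; move: hi; rewrite mem_iota.
move=> /h rim; case: (_.-1) => //= k; rewrite rim /=.
by elim: k => //= k ->; rewrite rr.
Qed.

Lemma kostka_rev_hook n (a : compn n) (n0 : (0 < n)%N) :
  kostka a (crev (hook_rho a n0)) = 1%N.
Proof.
have a0 := compn_size_gt0 a n0.
have bE := nth_crev_hook_rho a n0.
apply: (@kostka_eq1 _ _ _ (hook_filling (size a) a)) => [||T].
- rewrite /ssit (hook_filling_is_filling a a0) column1_hook_filling.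
  by rewrite iota_ltn_sorted all_sorted_hook_filling.
- exact: hook_filling_content.
- by move=> /and3P[fT sT _]; exact: hook_filling_uniq.
Qed.

Theorem proposition4p5 (n : nat) (n0 : (0 < n)%N) (alpha : compn n) :
  leading_index (@dualImm n) (rho (dualImm alpha)) (hook_rho alpha n0)
  /\ bcoef (@dualImm n) (rho (dualImm alpha)) (hook_rho alpha n0) = 1
  /\ exists T : filling,
       [/\ ssrit (crev alpha) T /\ content T = hook_rho alpha n0,
           forall T' : filling, ssrit (crev alpha) T' ->
             content T' = hook_rho alpha n0 -> T' = T,
           column1 T =i iota 1 (size alpha)
         & forall r : seq nat, r \in T ->
             forall x : nat, x \in behead r -> x = 1%N].
Proof.
have rhoE := rho_dualImm alpha.
have Mhook : Mcoef (hook_rho alpha n0) (rho (dualImm alpha)) = 1.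
  by rewrite rhoE Mcoef_sum_qM kostka_rev_hook.
have natz0 k : (k%:R != 0 :> int) = (k != 0%N) by rewrite natz.
have [lead coef] : leading_index (@dualImm n) (rho (dualImm alpha))
      (hook_rho alpha n0)
    /\ bcoef (@dualImm n) (rho (dualImm alpha)) (hook_rho alpha n0)
       = Mcoef (hook_rho alpha n0) (rho (dualImm alpha)).
  apply: unitri_leading.
  - by move=> a; rewrite /dualImm Mcoef_sum_qM kostka_diag.
  - by move=> a b; rewrite /dualImm Mcoef_sum_qM natz0; exact: kostka_lexle.
  - by move=> a; exact: sum_qM_expand.
  - exact: sum_qM_expand rhoE.
  - by rewrite Mhook.
  - move=> d; rewrite rhoE Mcoef_sum_qM natz0 => /kostka_size.
    by rewrite /= size_rev; exact: lexle_hook_rho.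
rewrite coef Mhook; split=> //; split=> //.
have a0 : (0 < size (crev alpha))%N by exact: compn_size_gt0.
have bE i : nth 0%N (hook_rho alpha n0) i
    = ((i < size (crev alpha)) + (i.+1 == 1) * (n - size (crev alpha)))%N.
  by rewrite size_rev nth_hook_rho.
exists (hook_filling 1 (crev alpha)); split.
- split; last exact: hook_filling_content.
  rewrite /ssrit hook_filling_is_filling // column1_hook_filling.
  by rewrite iota_ltn_sorted all_sorted_hook_filling // => x; exact: leqnn.
- by move=> T /and3P[fT sT _]; exact: hook_filling_uniq.
- by move=> x; rewrite column1_hook_filling size_rev.
- by move=> r rT x; exact: behead_hook_filling rT.
Qed.
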